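(* Let $A_0$ be an infinite set. There is a successful direct system of multi-embeddings $\langle T_n\ (n\in\omega);\ \Phi_m^n\ (m\le n)\rangle$, $T_n=\langle A_n,\mathcal F_n,D_n,G_n,\varphi_n\rangle$, whose first structure has underlying set $A_0$, such that for every $n$: (1) $|A_n|=|A_0|$; (2) $\mathcal F_n=\mathcal P(A_n)$; (3) $G_n=\mathrm{Sym}(A_n)$.
   Context: For $\mathcal F\subseteq\mathcal P(A)$: $\mathrm{Aut}(\mathcal F)$ is the group of permutations $\sigma$ of $A$ with $X\in\mathcal F\iff\sigma[X]\in\mathcal F$ for all $X\subseteq A$. A demand on $\mathcal F$ is a pair $d=(h^d,f^d)$, $h^d$ a finite injective partial function $A\to A$, $f^d$ a finite injective partial function $\mathcal F\to\mathcal F$, with $x\in X\iff h^d(x)\in f^d(X)$ for $x\in\mathrm{dom}\,h^d$, $X\in\mathrm{dom}\,f^d$; $D(A,\mathcal F)$ is the set of demands; $g\in\mathrm{Aut}(\mathcal F)$ satisfies $d$ if $g\supseteq h^d$ and $g[X]=f^d(X)$ for $X\in\mathrm{dom}\,f^d$. A structure $T=\langle A,\mathcal F,D,G,\varphi\rangle$ consists of a set $A$, $\mathcal F\subseteq\mathcal P(A)$, $D=D(A,\mathcal F)$, a subgroup $G\le\mathrm{Aut}(\mathcal F)$, and a partial satisfying homomorphism $\varphi$: a group homomorphism from the subgroup of the free group on $D$ generated by a subset $\mathrm{dom}\,\varphi\subseteq D$ into $G$ such that $\varphi(d)$ satisfies $d$ for all $d\in\mathrm{dom}\,\varphi$. Let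 $\bar T=A\cup\mathcal F\cup D\cup G$. A multi-embedding $\Phi:T_0\to T_1$ is a function on $\bar T_0$ such that $\Phi\restriction A_0$, $\Phi\restriction\mathcal F_0$, $\Phi\restriction D_0$ are injections into $A_1,\mathcal F_1,D_1$ respectively, $\Phi\restriction G_0$ is a group monomorphism into $G_1$, and for $x\in A_0,X\in\mathcal F_0,d\in D_0,g\in G_0$: (a) $x\in X\iff\Phi(x)\in\Phi(X)$; (b) $\Phi[\mathrm{dom}\,h^d]=\mathrm{dom}\,h^{\Phi(d)}$, $\Phi[\mathrm{dom}\,f^d]=\mathrm{dom}\,f^{\Phi(d)}$, $\Phi(h^d(x))=h^{\Phi(d)}(\Phi(x))$, $\Phi(f^d(X))=f^{\Phi(d)}(\Phi(X))$; (c) $\Phi(g(x))=\Phi(g)(\Phi(x))$ and $\Phi(g[X])=\Phi(g)[\Phi(X)]$; (d) if $d\in\mathrm{dom}\,\varphi_0$ then $\Phi(d)\in\mathrm{dom}\,\varphi_1$ and $\Phi(\varphi_0(d))=\varphi_1(\Phi(d))$. $\Phi$ is successful if moreover $\Phi(d)\in\mathrm{dom}\,\varphi_1$ for every $d\in D_0$. A direct system of multi-embeddings over a directed set $I$ (here $I=\omega$) consists of structures $T_i$ and multi-embeddings $\Phi_i^j:T_i\to T_j$ for $i\le j$ with $\Phi_i^i=\mathrm{id}$ and $\Phi_j^k\Phi_i^j=\Phi_i^k$ for $i\le j\le k$; it is successful if for every $i$ there is $j\ge i$ with $\Phi_i^j$ successful. *)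

(* Defs.v *)
From HB Require Import structures.
From mathcomp Require Import all_boot.
From mathcomp Require Import boolp classical_sets functions cardinality.

Set Implicit Arguments.
Unset Strict Implicit.
Unset Printing Implicit Defensive.


Local Open Scope classical_set_scope.
Local Open Scope group_scope.

Definition subgroup (G : groupType) (H : set G) : Prop := group_closed [in H].

Definition generated (G : groupType) (X : set G) : set G :=
  smallest (@subgroup G) X.

Definition morphism_on (G K : groupType) (H : set G) (f : G -> K) : Prop :=
  forall u v, H u -> H v -> f (u * v) = f u * f v.

(* The symmetric group of a type; the product is composition, acting on the
   left: (f * g) x = f (g x). *)

Record sym (A : Type) := Sym {
  sym_fun :> A -> A;
  sym_bij : bijective sym_fun
}.

Section SymGroup.
Variable A : Type.
Implicit Types f g h : sym A.

HB.instance Definition _ := gen_eqMixin (sym A).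
HB.instance Definition _ := gen_choiceMixin (sym A).

Lemma sym_eqP f g : (forall x, f x = g x) -> f = g.
Proof.
case: f g => [f fb] [g gb] /= /funext fg.
by move: fb gb; rewrite fg => fb gb; rewrite (Prop_irrelevance fb gb).
Qed.

Definition sym_one : sym A :=
  @Sym A id (@Bijective A A id id (fun=> erefl) (fun=> erefl)).

Definition sym_mul f g := Sym (bij_comp (sym_bij f) (sym_bij g)).

Lemma sym_inv_ex f : exists g : sym A, cancel f g /\ cancel g f.
Proof.
by case: (sym_bij f) => g fK gK; exists (Sym (Bijective gK fK)).
Qed.

Definition sym_inv f : sym A := projT1 (cid (sym_inv_ex f)).

Lemma sym_invK f : cancel f (sym_inv f) /\ cancel (sym_inv f) f.
Proof. exact: (projT2 (cid (sym_inv_ex f))). Qed.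

Fact sym_mulA : associative sym_mul.
Proof. by move=> f g h; apply: sym_eqP. Qed.

Fact sym_mul1 : left_id sym_one sym_mul.
Proof. by move=> f; apply: sym_eqP. Qed.

Fact sym_mulr1 : right_id sym_one sym_mul.
Proof. by move=> f; apply: sym_eqP. Qed.

Fact sym_mulV : left_inverse sym_one sym_inv sym_mul.
Proof. by move=> f; apply: sym_eqP => x /=; case: (sym_invK f). Qed.

Fact sym_mulrV : right_inverse sym_one sym_inv sym_mul.
Proof. by move=> f; apply: sym_eqP => x /=; case: (sym_invK f). Qed.

HB.instance Definition _ := isGroup.Build (sym A)
  sym_mulA sym_mul1 sym_mulr1 sym_mulV sym_mulrV.

Lemma sym1E x : (1 : sym A) x = x. Proof. by []. Qed.

Lemma symME f g x : (f * g) x = f (g x). Proof. by []. Qed.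

End SymGroup.

(* The free group on D, as reduced words; (d, true) is the letter d and
   (d, false) its inverse. *)

Section FreeGroup.
Variable D : choiceType.
Local Notation letter := (D * bool)%type.
Implicit Types (a b : letter) (u v w : seq letter).

Definition linv a : letter := (a.1, ~~ a.2).

Lemma linvK : involutive linv.
Proof. by case=> d b; rewrite /linv /= negbK. Qed.

Definition reduced w : bool := sorted (fun a b => b != linv a) w.

Record free_group := FreeGroup {
  word :> seq letter;
  word_reduced : reduced word
}.

HB.instance Definition _ := [isSub for word].
HB.instance Definition _ := [Choice of free_group by <:].

Definition push a w : seq letter :=
  if w is b :: w' then if b == linv a then w' else a :: w else [:: a].

Lemma reduced_push a w : reduced w -> reduced (push a w).
Proof.
case: w => //= b w; case: ifPn => [_|ba] /=; last by rewrite ba.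
exact: path_sorted.
Qed.

Lemma pushK a w : reduced w -> push a (push (linv a) w) = w.
Proof.
case: w => [|b w] /=; first by rewrite eqxx.
rewrite linvK; case: ifPn => [/eqP->|_]; last by rewrite /= eqxx.
by case: w => //= c w /andP[/negPf-> _].
Qed.

Lemma reduced_foldr u v : reduced v -> reduced (foldr push v u).
Proof. by move=> rv; elim: u => //= a u; apply: reduced_push. Qed.

Lemma foldr_push a u v : reduced v ->
  foldr push v (push a u) = push a (foldr push v u).
Proof.
move=> rv; case: u => //= b u; case: ifPn => // /eqP->.
by rewrite pushK// reduced_foldr.
Qed.

Lemma foldr_push_id u : reduced u -> foldr push [::] u = u.
Proof.
elim: u => //= a u IH au; rewrite IH; last exact: path_sorted au.
by case: u au {IH} => //= b u /andP[/negPf->].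
Qed.

Lemma reduced_linv u : reduced u -> reduced (rev (map linv u)).
Proof.
rewrite /reduced rev_sorted sorted_map; apply: sub_sorted => a b /=.
by apply: contra => /eqP->; rewrite !linvK.
Qed.

Definition free_one : free_group := @FreeGroup [::] isT.

Definition free_mul (x y : free_group) : free_group :=
  FreeGroup (reduced_foldr x (word_reduced y)).

Definition free_inv (x : free_group) : free_group :=
  FreeGroup (reduced_linv (word_reduced x)).

Definition free_gen (d : D) : free_group := @FreeGroup [:: (d, true)] isT.

Fact free_mulA : associative free_mul.
Proof.
move=> [u ru] [v rv] [w rw]; apply: val_inj => /=.
by elim: u {ru} => //= a u ->; rewrite foldr_push.
Qed.

Fact free_mul1 : left_id free_one free_mul.
Proof. by move=> x; apply: val_inj. Qed.

Fact free_mulr1 : right_id free_one free_mul.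
Proof. by move=> [u ru]; apply: val_inj; rewrite /= foldr_push_id. Qed.

Fact free_mulV : left_inverse free_one free_inv free_mul.
Proof.
move=> [u ru]; apply: val_inj => /= {ru}; elim: u => //= a u IH.
by rewrite rev_cons foldr_rcons /= linvK eqxx.
Qed.

Fact free_mulrV : right_inverse free_one free_inv free_mul.
Proof.
have invK x : free_inv (free_inv x) = x.
  apply: val_inj => /=; rewrite map_rev revK -map_comp.
  by rewrite -[RHS]map_id; apply: eq_map => a /=; rewrite linvK.
by move=> x; rewrite -[in LHS](invK x) invK -{1}(invK x) free_mulV.
Qed.

HB.instance Definition _ := isGroup.Build free_group
  free_mulA free_mul1 free_mulr1 free_mulV free_mulrV.

End FreeGroup.

(* Partial functions are option-valued functions, so that equality of partial
   functions (and of demands) is equality of graphs. *)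

Definition pdom (T U : Type) (f : T -> option U) : set T := [set x | f x].

Definition finite_pinj (T U : Type) (f : T -> option U) : Prop :=
  finite_set (pdom f) /\ set_inj (pdom f) f.

Section Demands.
Variables (A : Type) (F : set (set A)).

Definition Aut : set (sym A) :=
  [set g | forall X : set A, F X <-> F (g @` X)].

Record demand := Demand {
  dpt : A -> option A;
  dset : set A -> option (set A);
  dpt_finj : finite_pinj dpt;
  dset_finj : finite_pinj dset;
  dset_sub : forall X Y, dset X = Some Y -> F X /\ F Y;
  demand_compat : forall x y X Y,
    dpt x = Some y -> dset X = Some Y -> (X x <-> Y y)
}.

HB.instance Definition _ := gen_eqMixin demand.
HB.instance Definition _ := gen_choiceMixin demand.

Definition satisfies (g : sym A) (d : demand) : Prop :=
  (forall x y, dpt d x = Some y -> g x = y) /\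
  (forall X Y, dset d X = Some Y -> g @` X = Y).

End Demands.

(* The component D of a structure is the type demand setfam. The homomorphism
   phi is a total function whose values outside the subgroup generated by
   dom_phi are irrelevant. *)
Record structure := Structure {
  carrier :> Type;
  setfam : set (set carrier);
  symgrp : set (sym carrier);
  dom_phi : set (demand setfam);
  phi : free_group (demand setfam) -> sym carrier;
  symgrp_subgroup : subgroup symgrp;
  symgrp_Aut : symgrp `<=` Aut setfam;
  phi_symgrp : set_fun (generated (@free_gen _ @` dom_phi)) symgrp phi;
  phi_morph : morphism_on (generated (@free_gen _ @` dom_phi)) phi;
  phi_satisfies : forall d, dom_phi d -> satisfies (phi (free_gen d)) d
}.

Arguments setfam : clear implicits.
Arguments symgrp : clear implicits.
Arguments dom_phi {s}.
Arguments phi {s}.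

(* The four components of a multi-embedding on the disjoint union of A, F, D
   and G. The components emb_set and emb_sym are total functions that matter
   only on setfam and on symgrp, respectively. *)
Record multi_embedding (T0 T1 : structure) := MultiEmbedding {
  emb_pt :> T0 -> T1;
  emb_set : set T0 -> set T1;
  emb_dem : demand (setfam T0) -> demand (setfam T1);
  emb_sym : sym T0 -> sym T1;
  emb_pt_inj : injective emb_pt;
  emb_set_fun : set_fun (setfam T0) (setfam T1) emb_set;
  emb_set_inj : set_inj (setfam T0) emb_set;
  emb_dem_inj : injective emb_dem;
  emb_sym_fun : set_fun (symgrp T0) (symgrp T1) emb_sym;
  emb_sym_inj : set_inj (symgrp T0) emb_sym;
  emb_sym_morph : morphism_on (symgrp T0) emb_sym;
  emb_mem : forall x X, setfam T0 X -> (X x <-> emb_set X (emb_pt x));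
  emb_dpt_dom : forall d, emb_pt @` pdom (dpt d) = pdom (dpt (emb_dem d));
  emb_dset_dom : forall d, emb_set @` pdom (dset d) = pdom (dset (emb_dem d));
  emb_dpt : forall d x y, dpt d x = Some y ->
    dpt (emb_dem d) (emb_pt x) = Some (emb_pt y);
  emb_dset : forall d X Y, dset d X = Some Y ->
    dset (emb_dem d) (emb_set X) = Some (emb_set Y);
  emb_act_pt : forall g x, symgrp T0 g -> emb_pt (g x) = emb_sym g (emb_pt x);
  emb_act_set : forall g X, symgrp T0 g -> setfam T0 X ->
    emb_set (g @` X) = emb_sym g @` emb_set X;
  emb_dom_phi : forall d, dom_phi d -> dom_phi (emb_dem d);
  emb_phi : forall d, dom_phi d ->
    emb_sym (phi (free_gen d)) = phi (free_gen (emb_dem d))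
}.

Definition successful (T0 T1 : structure) (Phi : multi_embedding T0 T1) : Prop :=
  forall d, dom_phi (emb_dem Phi d).

Record direct_system := DirectSystem {
  stage :> nat -> structure;
  bond : forall m n, m <= n -> multi_embedding (stage m) (stage n);
  bond_id : forall n (Phi := bond (leqnn n)),
    [/\ forall x, Phi x = x,
        forall X, setfam (stage n) X -> emb_set Phi X = X,
        forall d, emb_dem Phi d = d
      & forall g, symgrp (stage n) g -> emb_sym Phi g = g];
  bond_comp : forall i j k (ij : i <= j) (jk : j <= k)
      (Phi := bond ij) (Psi := bond jk) (Chi := bond (leq_trans ij jk)),
    [/\ forall x, Psi (Phi x) = Chi x,
        forall X, setfam (stage i) X ->
          emb_set Psi (emb_set Phi X) = emb_set Chi X,
        forall d, emb_dem Psi (emb_dem Phi d) = emb_dem Chi d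
      & forall g, symgrp (stage i) g ->
          emb_sym Psi (emb_sym Phi g) = emb_sym Chi g]
}.

Definition successful_system (S : direct_system) : Prop :=
  forall i, exists j (ij : i <= j), successful (bond S ij).

(* Main.v *)
(* Given a structure on A with all subsets and all permutations, adjoin to A the
   pairs (s, t) of a list s over A and a list t of bit strings, and enlarge X to
   X together with all (s, t) such that the characteristic vector of X along s
   occurs in t. This is Hausdorff's independent family: for finitely many
   distinct sets, every Boolean combination of their enlargements has |A|
   elements, which remains so after deleting a finite set. Hence for every
   demand on A a bijection between the Boolean atoms of the enlarged sets in the
   domain and those in the range, extending the finite point map, satisfies the
   transported demand; since phi is only required to be a homomorphism on the
   free group generated by its domain, these permutations may be chosen
   independently of each other. The construction is functorial, so Sym(A) acts
   on the new set compatibly, and it preserves cardinality because |A x A| = |A|.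
   Starting from the empty phi and iterating gives the system. *)
From HB Require Import structures.
Require Import Defs.
From mathcomp Require Import all_boot.
From mathcomp Require Import boolp classical_sets functions cardinality.

Set Implicit Arguments.
Unset Strict Implicit.
Unset Printing Implicit Defensive.

Local Open Scope classical_set_scope.
Local Open Scope card_scope.

(** * Cardinals *)

(** Choice selects a function inside [R]. Empty [A] is split off because only a point of [A]
    supplies a default value in [U]. *)
Lemma card_le_rel (T U : Type) (A : set T) (B : set U) (R : T -> U -> Prop) :
  (forall x, A x -> exists2 y, B y & R x y) ->
  (forall x x' y, A x -> A x' -> R x y -> R x' y -> x = x') -> A #<= B.
Proof.
move=> Rtot Rinj; have [->|/set0P[x0 Ax0]] := eqVneq A set0; first exact: card_ge0.
have [y0 _ _] := Rtot _ Ax0.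
have /choice[f fP] : forall x, exists y, A x -> B y /\ R x y.
  move=> x; have [Ax|nAx] := pselect (A x); last by exists y0.
  by have [y By Rxy] := Rtot _ Ax; exists y.
have /injfunPex[g] : exists2 g : T -> U, set_fun A B g & set_inj A g.
  exists f => [x /fP[]//|x x' /set_mem Ax /set_mem Ax' ff].
  have [_ Rx] := fP _ Ax; have [_ Rx'] := fP _ Ax'.
  by apply: (Rinj _ _ (f x)) => //; rewrite ff.
exact: inj_card_le.
Qed.

Lemma inj_le_card (T U : Type) (f : T -> U) : injective f -> [set: T] #<= [set: U].
Proof.
move=> fI; apply: (card_le_rel (R := fun x y => f x = y)) => [x _|x x' y _ _ <-].
  by exists (f x).
by move/fI.
Qed.

Lemma card_le_fun (T U : Type) (u0 : U) (A : set T) (B : set U) : A #<= B ->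
  exists2 f : T -> U, (forall x, A x -> B (f x)) &
    (forall x x', A x -> A x' -> f x = f x' -> x = x').
Proof.
pose pU := isPointed.Build U u0.
pose V : pointedType := HB.pack U (gen_eqMixin U) (gen_choiceMixin U) pU.
move=> /(@pcard_leP _ V)[f]; exists f => [x Ax|x x' Ax Ax']; first exact: funS.
by apply: (@inj _ _ _ f); apply: mem_set.
Qed.

(** Zorn's lemma for graphs of partial bijections between [A] and [B]: if a maximal one missed a
    point on each side, that pair could be added. *)
Lemma card_le_total (T U : Type) (A : set T) (B : set U) : A #<= B \/ B #<= A.
Proof.
pose P (G : set (T * U)) := (forall u, G u -> A u.1 /\ B u.2) /\
  (forall u v, G u -> G v -> (u.1 = v.1 <-> u.2 = v.2)).
have [|G [[GAB Ginj] Gmax]] := @Zorn_bigcup _ P.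
  move=> F FP Ftot; split=> [u [K /FP[KAB _] /KAB]//|u v [K FK Ku] [L FL Lv]].
  have [KL|LK] := Ftot _ _ FK FL.
    by have [_] := FP _ FL; apply=> //; apply: KL.
  by have [_] := FP _ FK; apply=> //; apply: LK.
have [domA|/existsNP[a /not_implyP[Aa aG]]] :=
    pselect (forall x, A x -> exists y, G (x, y)).
  left; apply: (card_le_rel (R := fun x y => G (x, y))) => [x Ax|x x' y _ _ Gx Gx'].
    by have [y Gxy] := domA _ Ax; exists y => //; have [] := GAB _ Gxy.
  exact: (Ginj _ _ Gx Gx').2.
have [ranB|/existsNP[b /not_implyP[Bb bG]]] :=
    pselect (forall y, B y -> exists x, G (x, y)).
  right; apply: (card_le_rel (R := fun y x => G (x, y))) => [y By|y y' x _ _ Gy Gy'].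
    by have [x Gxy] := ranB _ By; exists x => //; have [] := GAB _ Gxy.
  exact: (Ginj _ _ Gy Gy').1.
exfalso; apply: (Gmax (G `|` [set (a, b)])).
  split=> [u Gu|sub]; first by left.
  by apply: aG; exists b; apply: sub; right.
split=> [u [/GAB//|->//]|[x y] [x' y'] [Guv|->] [Guv'|->]//=].
- exact: Ginj Guv Guv'.
- by split=> e; subst; [case: aG; exists y|case: bG; exists x].
- by split=> e; subst; [case: aG; exists y'|case: bG; exists x'].
Qed.

(** * Pairing functions on infinite sets *)

Definition pairing_graph (T : Type) (S : set T) (f : T -> T -> T) : set (T * T * T) :=
  [set u | [/\ S u.1.1, S u.1.2 & f u.1.1 u.1.2 = u.2]].

Definition pairing_on (T : Type) (S : set T) (f : T -> T -> T) : Prop :=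
  (forall x y, S x -> S y -> S (f x y)) /\
  (forall x y x' y', S x -> S y -> S x' -> S y' ->
     f x y = f x' y' -> x = x' /\ y = y').

(** Injections of the square of [S] into [S], encoded as graphs so that Zorn's lemma can take unions
    of chains. *)
Definition is_pairing (T : Type) (G : set (T * T * T)) : Prop :=
  exists S f, pairing_on S f /\ G = pairing_graph S f.

(** Closure, single-valuedness and injectivity each involve only two triples at a time, so they can
    be checked inside a common [K]. *)
Lemma is_pairing_directed (T : Type) (t0 : T) (H : set (T * T * T)) :
  (forall u v, H u -> H v -> exists K, [/\ is_pairing K, K `<=` H, K u & K v]) ->
  is_pairing H.
Proof.
(* The underlying set is read off the diagonal of the graph. *)
move=> Hdir; pose S := [set x | exists z, H (x, x, z)].
have Hfun x y z z' : H (x, y, z) -> H (x, y, z') -> z = z'.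
  by move=> /Hdir /[apply] -[K [[S' [f [_ ->]]] _ [/= _ _ <-] [/= _ _ <-]]].
have HS x y : S x -> S y -> exists2 z, H (x, y, z) & S z.
  move=> [z Hx] [z' Hy].
  have [K [[S' [f [[fS _] ->]]] KH [/= Sx _ _] [/= Sy _ _]]] := Hdir _ _ Hx Hy.
  exists (f x y); first exact: KH.
  by exists (f (f x y) (f x y)); apply: KH; split=> //=; apply: fS.
have SH x y z : H (x, y, z) -> S x /\ S y.
  move=> /[dup] /Hdir/[apply] -[K [[S' [f [_ ->]]] KH [/= Sx Sy _] _]].
  by split; [exists (f x x)|exists (f y y)]; apply: KH.
have /choice[f fP] : forall u : T * T, exists z, S u.1 -> S u.2 -> H (u, z) /\ S z.
  move=> [x y]; have [Sx|?] := pselect (S x); last by exists t0.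
  have [Sy|?] := pselect (S y); last by exists t0.
  by have [z ? ?] := HS _ _ Sx Sy; exists z.
exists S, (fun x y => f (x, y)); split; first split=> [x y Sx Sy|x y x' y' Sx Sy Sx' Sy' ff].
- by have [] := fP (x, y) Sx Sy.
- have [H1 _] := fP (x, y) Sx Sy; have [H2 _] := fP (x', y') Sx' Sy'.
  have [K [[S' [g [[_ gI] KE]]] _]] := Hdir _ _ H1 H2.
  by rewrite {}KE => -[/= ? ? e] [/= ? ? e']; apply: gI => //; rewrite e e'.
apply/seteqP; split=> [[[x y] z] Hxy|[[x y] z] [/= Sx Sy <-]].
  have [Sx Sy] := SH _ _ _ Hxy; split=> //=.
  by apply: Hfun Hxy; have [] := fP (x, y) Sx Sy.
by have [] := fP (x, y) Sx Sy.
Qed.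

(* The points of [D] inside, respectively outside, [S] are tagged with [c0], respectively [c1]. *)
Lemma pairing_on_double (T : Type) (S : set T) (f : T -> T -> T) (D : set T)
    (e : T -> T) (c0 c1 : T) :
  pairing_on S f -> S c0 -> S c1 -> c0 <> c1 ->
  (forall x, D x -> ~ S x -> S (e x)) ->
  (forall x y, D x -> D y -> ~ S x -> ~ S y -> e x = e y -> x = y) ->
  exists2 r : T -> T, (forall x, D x -> S (r x)) &
    (forall x y, D x -> D y -> r x = r y -> x = y).
Proof.
move=> [fS fI] S0 S1 c01 eS eI.
exists (fun x => if pselect (S x) then f c0 x else f c1 (e x)) => [x Dx|x y Dx Dy].
  by case: pselect => Sx; apply: fS => //; apply: eS.
case: pselect => Sx; case: pselect => Sy.
- by case/fI.
- by case/fI => //; apply: eS.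
- by case/fI => // [|/esym//]; apply: eS.
- by case/fI; [|exact: eS| |exact: eS|move=> _; apply: eI].
Qed.

(** Take a maximal pairing extending one on a countable subset. Either its set [S] is large enough
    for all of [T] to inject into it, or the pairing extends further. *)
Lemma infinite_pairing (T : Type) : infinite_set [set: T] ->
  exists f : T -> T -> T, forall x y x' y', f x y = f x' y' -> x = x' /\ y = y'.
Proof.
move=> Tinf; have [t0 _] := infinite_setN0 Tinf.
have [i _ iI] := card_le_fun t0 ((infiniteP _).1 Tinf).
pose S0 := range i.
have /choice[j jI] : forall x, exists n, S0 x -> i n = x.
  by move=> x; have [[n _ <-]|?] := pselect (S0 x); [exists n|exists 0].
pose f0 x y := i (pickle (j x, j y)).
have G0P : is_pairing (pairing_graph S0 f0).
  exists S0, f0; split=> //; split=> [x y _ _|x y x' y' Sx Sy Sx' Sy' /iI]; first exact: imageT.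
  move=> /(_ I I)/(pcan_inj pickleK)[jx jy].
  by rewrite -(jI x)// -(jI y)// jx jy !jI.
pose G0 := pairing_graph S0 f0.
(* [G0] is joined to [G] inside the predicate because the empty chain, whose union is empty, must
   satisfy it too. *)
have [|G [Gpair Gmax]] := @Zorn_bigcup _ (fun G => is_pairing (G0 `|` G)).
  move=> F FP Ftot; apply: (is_pairing_directed t0).
  have one u : (G0 `|` \bigcup_(X in F) X) u -> G0 u \/ exists2 K, F K & K u.
    by case; [left|right].
  have sub K : F K -> G0 `|` K `<=` G0 `|` \bigcup_(X in F) X.
    by move=> FK v [|Kv]; [left|right; exists K].
  move=> u v /one[Gu|[K FK Ku]] /one[Gv|[L FL Lv]].
  - by exists G0; split=> // w; left.
  - by exists (G0 `|` L); split; [exact: FP|exact: sub|left|right].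
  - by exists (G0 `|` K); split; [exact: FP|exact: sub|right|left].
  - have [KL|LK] := Ftot _ _ FK FL.
      by exists (G0 `|` L); split; [exact: FP|exact: sub|right; apply: KL|right].
    by exists (G0 `|` K); split; [exact: FP|exact: sub|right|right; apply: LK].
have [S [f [[fS fI] GE]]] := Gpair.
have S0S x : S0 x -> S x.
  move=> S0x; suff [] : pairing_graph S f (x, x, f0 x x) by [].
  by rewrite -GE; left; split.
have Sc0 : S (i 0) by apply/S0S/imageT.
have Sc1 : S (i 1) by apply/S0S/imageT.
have c01 : i 0 <> i 1 by move=> /iI; move=> /(_ I I).
have double := @pairing_on_double _ S f _ _ (i 0) (i 1) (conj fS fI) Sc0 Sc1 c01.
(* If the complement injects into [S], so does all of [T], and [f] pulls back to a pairing of
   [T]. *)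
have [SleC|CleS] := card_le_total S (~` S); last first.
  have [e eS eI] := card_le_fun t0 CleS.
  have [r rS rI] := double setT e (fun x _ => eS x) (fun x y _ _ => eI x y).
  exists (fun x y => f (r x) (r y)) => x y x' y' /fI.
  by case=> [||||/rI-> // /rI->//]; apply: rS.
(* Otherwise [e] places a copy of [S] outside [S]; the pairing will be extended to the union [D] of
   both. *)
have [e eS eI] := card_le_fun t0 SleC.
have /choice[e' e'P] : forall y, exists x, (e @` S) y -> S x /\ e x = y.
  by move=> y; have [[x Sx <-]|?] := pselect ((e @` S) y); [exists x|exists t0].
have e'K x : S x -> e' (e x) = x.
  by move=> Sx; have [|S' ee] := e'P (e x); [exists x|exact: eI ee].
pose D := S `|` e @` S.
have [||r rD rI] := double D e'.
- by move=> x [//|[y Sy <-]] _; rewrite e'K.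
- move=> x y [//|[x' Sx' <-]] [//|[y' Sy' <-]] _ _.
  by rewrite !e'K// => ->.
(* Pairs from [S] keep their value in [S]; all other pairs are sent into the copy, so the two cases
   cannot collide. *)
pose g x y := if pselect (S x /\ S y) then f x y else e (f (r x) (r y)).
have gP : pairing_on D g.
  split=> [x y Dx Dy|x y x' y' Dx Dy Dx' Dy']; rewrite /g.
    case: pselect => [[Sx Sy]|?]; first by left; apply: fS.
    by right; exists (f (r x) (r y)) => //; apply: fS; apply: rD.
  have fr u v : D u -> D v -> S (f (r u) (r v)) by move=> Du Dv; apply: fS; apply: rD.
  case: pselect => [[Sx Sy]|nxy]; case: pselect => [[Sx' Sy']|nxy'] /=.
  - exact: fI.
  - by move=> fe; case: (eS _ (fr _ _ Dx' Dy')); rewrite -fe; apply: fS.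
  - by move=> fe; case: (eS _ (fr _ _ Dx Dy)); rewrite fe; apply: fS.
  - move=> /(eI _ _ (fr _ _ Dx Dy) (fr _ _ Dx' Dy'))/fI.
    by case=> [||||/rI-> // /rI->//]; apply: rD.
have Gg : G0 `|` G `<=` pairing_graph D g.
  rewrite GE => -[[x y] z] [/= Sx Sy <-]; split; [by left..|].
  by rewrite /= /g; case: pselect => // -[].
exfalso; apply: (Gmax (pairing_graph D g)); last first.
  exists D, g; split=> //; apply/seteqP; split=> [u [G0u|//]|u]; last by right.
  by apply: Gg; left.
split=> [u Gu|]; first by apply: Gg; right.
(* [c] lies outside [S], so the triple at [(c, c)] makes the extension strict. *)
pose c := e (i 0); move=> sub.
have Dc : D c by right; exists (i 0).
suff [/= Sc _ _] : pairing_graph S f (c, c, g c c) by apply: eS Sc.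
by rewrite -GE; right; apply: sub.
Qed.
Local Open Scope group_scope.

(** * Homomorphisms from the free group *)

Section FreeGroupEval.
Variables (D : choiceType) (K : groupType) (psi : D -> K).

Definition letter_eval (a : D * bool) : K := if a.2 then psi a.1 else (psi a.1)^-1.

Definition free_eval (w : free_group D) : K :=
  foldr (fun a k => letter_eval a * k) 1 (word w).

Lemma letter_eval_linv (a : D * bool) : letter_eval (linv a) = (letter_eval a)^-1.
Proof. by case: a => d [] /=; rewrite /letter_eval //= invgK. Qed.

(** [push] either prepends a letter or cancels it against its inverse, and evaluation respects both.
    Values on generators can thus be prescribed freely. *)
Lemma free_evalM (u v : free_group D) : free_eval (u * v) = free_eval u * free_eval v.
Proof.
case: u v => [u ru] [v rv]; rewrite /free_eval /= {ru rv}.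
elim: u => [|a u IH] /=; first by rewrite mul1g.
rewrite -mulgA -IH; case: (foldr _ v u) => [|b w] //=.
by case: eqP => [->|] //=; rewrite letter_eval_linv mulVKg.
Qed.

Lemma free_eval_gen (d : D) : free_eval (free_gen d) = psi d.
Proof. by rewrite /free_eval /= mulg1. Qed.

End FreeGroupEval.

(** * Hausdorff's independent family *)

(** [p] labels points as arguments, [q] as values. On each label the points left over by [h] are
    matched by a bijection, and these are glued with [h]. *)
Lemma extend_fibrewise (B T : Type) (p q : B -> T) (h : B -> option B) :
  (forall x y, h x = Some y -> q y = p x) ->
  (forall x x' y, h x = Some y -> h x' = Some y -> x = x') ->
  (forall t, [set x | h x = None /\ p x = t] #=
             [set y | (forall x, h x <> Some y) /\ q y = t]) ->
  exists g : sym B, (forall x y, h x = Some y -> g x = y) /\ (forall x, q (g x) = p x).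
Proof.
move=> hpq hI fib.
have [[b0 _]|nB] := pselect ([set: B] !=set0); last first.
  by exists 1; split=> x; case: nB; exists x.
pose V : pointedType :=
  HB.pack B (gen_eqMixin B) (gen_choiceMixin B) (isPointed.Build B b0).
have /choice[beta betaP] := fun t => (@card_set_bijP _ V _ _ (fib t)).
pose g x := if h x is Some y then y else beta (p x) x.
have gS x y : h x = Some y -> g x = y by rewrite /g => ->.
have gN x : h x = None -> (forall x', h x' <> Some (g x)) /\ q (g x) = p x.
  by move=> hx; rewrite /g hx; have [bF _ _] := betaP (p x); apply: bF.
have gq x : q (g x) = p x.
  by case E: (h x) => [y|]; [rewrite (gS _ _ E); exact: hpq|case: (gN _ E)].
suff gB : bijective g by exists (Sym gB).
rewrite -setTT_bijective; split=> //.
- move=> x x' _ _ gg; case E: (h x) => [y|]; case E': (h x') => [y'|].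
  + by apply: (hI _ _ _ E); rewrite E' -(gS _ _ E) gg (gS _ _ E').
  + by case: (gN _ E') => /(_ x); rewrite E -gg (gS _ _ E).
  + by case: (gN _ E) => /(_ x'); rewrite E' gg (gS _ _ E').
  + have pp : p x' = p x by rewrite -!gq gg.
    have [_ bI _] := betaP (p x); apply: bI; try by apply: mem_set.
    by move: gg; rewrite /g E E' pp.
- move=> y _; have [[x hx]|hy] := pselect (exists x, h x = Some y).
    by exists x; rewrite ?(gS _ _ hx).
  have [_ _ /(_ y)[|x [hx px] <-]] := betaP (q y).
    by split=> // x hx; apply: hy; exists x.
  by exists x => //; rewrite /g hx px.
Qed.

Notation hausdorff A := (A + seq A * seq (seq bool))%type.

Section Hausdorff.
Variable A : choiceType.
Implicit Types (X Y : set A) (g : sym A) (b : hausdorff A).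

(* On the right summand this is Hausdorff's independent family, with lists in
   place of finite sets so that [sym A] acts by [map] and cardinals are easy. *)
Definition hset X : set (hausdorff A) :=
  [set b | match b with
           | inl x => X x
           | inr (s, t) => [seq `[< X x >] | x <- s] \in t
           end].

Definition htrace (Z : set (hausdorff A)) : set A := [set x | Z (inl x)].

Lemma hsetK : cancel hset htrace.
Proof. by move=> X; apply/seteqP; split. Qed.

Lemma hset_inj : injective hset.
Proof. exact: can_inj hsetK. Qed.

Definition hmap (f : A -> A) b : hausdorff A :=
  match b with inl x => inl (f x) | inr (s, t) => inr (map f s, t) end.

Lemma hmapK (f f' : A -> A) : cancel f f' -> cancel (hmap f) (hmap f').
Proof. by move=> fK [x|[s t]] /=; rewrite ?fK ?(mapK fK). Qed.

Lemma hmap_bij g : bijective (hmap g).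
Proof. by case: (sym_bij g) => g' gK g'K; exists (hmap g'); apply: hmapK. Qed.

Definition hsym g : sym (hausdorff A) := Sym (hmap_bij g).

Lemma hsymM g g' : hsym (g * g') = hsym g * hsym g'.
Proof. by apply: sym_eqP => -[x|[s t]] //=; rewrite map_comp. Qed.

Lemma hsym_inj : injective hsym.
Proof.
move=> g g' gg; apply: sym_eqP => x.
by have [] : hsym g (inl x) = hsym g' (inl x) by rewrite gg.
Qed.

(** Moving both the set and the list by [g] leaves the characteristic vector unchanged. *)
Lemma hset_hsym g X b : hset (g @` X) (hsym g b) <-> hset X b.
Proof.
have gI : injective g by exact: bij_inj (sym_bij g).
have gX x : (g @` X) (g x) <-> X x by split=> [[y Xy /gI<-]//|Xx]; exists x.
case: b => [x|[s t]]; first exact: gX.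
rewrite /hset /= -map_comp; suff /eq_map -> :
    (fun x => `[< (g @` X) x >]) \o g =1 (fun x => `[< X x >]) by [].
by move=> x; apply: (asbool_equiv_eq (gX x)).
Qed.

Lemma hset_act g X : hset (g @` X) = hsym g @` hset X.
Proof.
apply/seteqP; split=> [b|_ [b Xb <-]]; last exact/hset_hsym.
have [g' _ gK] := sym_bij (hsym g).
by rewrite -{1}(gK b) => /hset_hsym Xb; exists (g' b).
Qed.

Lemma card_hausdorff : infinite_set [set: A] -> [set: hausdorff A] #<= [set: A].
Proof.
move=> Ainf; have [f fI] := infinite_pairing Ainf.
have [x0 _] := infinite_setN0 Ainf.
have [i _ iI0] := card_le_fun x0 ((infiniteP _).1 Ainf).
have iI m n : i m = i n -> m = n by exact: iI0.
(* The length is stored because the iterated pairing alone may identify lists of different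
   lengths. *)
pose code (s : seq A) := f (i (size s)) (foldr f x0 s).
have codeI s s' : code s = code s' -> s = s'.
  move=> /fI[/iI]; elim: s s' => [|x s IH] [|x' s'] //= [ss] /fI[-> ff].
  by rewrite (IH _ ss ff).
pose F b := match b with
  | inl x => f (i 0%N) x
  | inr (s, t) => f (i 1%N) (f (code s) (i (pickle t))) end.
apply: (inj_le_card (f := F)).
case=> [x|[s t]] [x'|[s' t']] /fI[/iI// _].
  by move=> ->.
by move=> /fI[/codeI-> /iI/(pcan_inj pickleK)->].
Qed.

(** If [s] separates the finitely many sets [c i], their traces along [s] are distinct, so taking
    for [t] the traces with index in [tau] realizes the atom. Padding [s] with copies of a point [x]
    yields as many solutions as [A] has elements. *)
Lemma card_atom (I : choiceType) (D : set I) (c : I -> set A) (tau : set I)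
    (R : set (hausdorff A)) : infinite_set [set: A] ->
  finite_set D -> finite_set R -> (forall i j, D i -> D j -> c i = c j -> i = j) ->
  [set: A] #<= [set b | ~ R b /\ forall i, D i -> (hset (c i) b <-> tau i)].
Proof.
move=> Ainf /finite_seqP[ds ->] /finite_seqP[r ->] cI.
have [x0 _] := infinite_setN0 Ainf.
have /choice[sep sepP] : forall ij : I * I, exists x,
    [set` ds] ij.1 -> [set` ds] ij.2 -> (c ij.1 x <-> c ij.2 x) -> ij.1 = ij.2.
  move=> [i j] /=; have [cij|/existsNP[x ncij]] := pselect (forall x, c i x <-> c j x).
    by exists x0 => ids jds _; apply: cI => //; apply/seteqP; split=> x; apply cij.
  by exists x.
pose s0 := [seq sep (i, j) | i <- ds, j <- ds].
pose len b := if b is inr (s, t) then size s else 0.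
(* The padding makes the list longer than any occurring in [R], so [R] is avoided; [n] is positive,
   so [x] is the head of the list and can be recovered. *)
pose n := (\max_(b <- r) len b).+1.
pose s x := nseq n x ++ s0.
pose trace x i := [seq `[< c i y >] | y <- s x].
pose t x := [seq trace x i | i <- ds & `[< tau i >]].
apply: (card_le_rel (R := fun x b => b = inr (s x, t x))) => [x _|x x' b _ _ -> [] //].
exists (inr (s x, t x)) => //; split=> [/= rb|i ids].
  suff : len (inr (s x, t x)) < n.
    by rewrite /= size_cat size_nseq ltnNge leq_addr.
  by rewrite ltnS; apply: (@leq_bigmax_seq _ r xpredT len).
change (trace x i \in t x <-> tau i); split=> [/mapP[j]|ti].
  rewrite mem_filter /trace => /andP[/asboolP tj jds] /eq_in_map cij.
  suff -> : i = j by [].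
  apply: (sepP (i, j)) => //=.
  have /cij : sep (i, j) \in s x.
    by rewrite mem_cat; apply/orP; right; apply/allpairsP; exists (i, j).
  by move=> e; split=> /asboolP; [rewrite e|rewrite -e] => /asboolP.
by apply/mapP; exists i => //; rewrite mem_filter; apply/andP; split=> //; apply/asboolP.
Qed.

End Hausdorff.
(** * Demands *)

Section PushPartial.
Variables (T U : Type) (e : T -> U) (f : T -> option T).
Hypothesis e_inj : injective e.

Definition push_pfun (u : U) : option U :=
  if pselect (exists x, e x = u) is left ex then omap e (f (projT1 (cid ex))) else None.

Lemma push_pfunE (x : T) : push_pfun (e x) = omap e (f x).
Proof.
rewrite /push_pfun; case: pselect => [ex|]; last by case; exists x.
by case: cid => /= x' /e_inj ->.
Qed.

Lemma push_pfunP (u v : U) : push_pfun u = Some v <->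
  exists x y, [/\ f x = Some y, u = e x & v = e y].
Proof.
split=> [|[x [y [fx -> ->]]]]; last by rewrite push_pfunE fx.
rewrite /push_pfun; case: pselect => // ex; case: cid => /= x <-.
by case E: (f x) => [y|] //= [<-]; exists x, y.
Qed.

Lemma pdom_push : e @` pdom f = pdom push_pfun.
Proof.
apply/seteqP; split=> [_ [x fx <-]|u] /=; rewrite /pdom /=.
  by rewrite push_pfunE; move: fx; rewrite /pdom /=; case: (f x).
case E: (push_pfun u) => [v|//] _; have [x [y [fx -> _]]] := (push_pfunP _ _).1 E.
by exists x => //; rewrite /pdom /= fx.
Qed.

Lemma finite_pinj_push : finite_pinj f -> finite_pinj push_pfun.
Proof.
move=> [ffin fI]; split; first by rewrite -pdom_push; apply: finite_image.
move=> u u' /set_mem; rewrite /pdom /=; case E: (push_pfun u) => [v|//] _ _ /esym E'.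
have [x [y [fx -> vy]]] := (push_pfunP _ _).1 E.
have [x' [y' [fx' -> vy']]] := (push_pfunP _ _).1 E'.
have yy' : y = y' by apply: e_inj; rewrite -vy -vy'.
by congr e; apply: fI; rewrite ?fx ?fx' ?yy' //; apply: mem_set; rewrite /pdom /= ?fx ?fx'.
Qed.

End PushPartial.

Lemma push_pfun_inj (T U : Type) (e : T -> U) : injective e ->
  injective (push_pfun e).
Proof.
move=> eI f f' ff; apply/funext => x; have := congr1 (fun h => h (e x)) ff.
by rewrite /= !push_pfunE//; case: (f x) (f' x) => [y|] [y'|] //= [/eI->].
Qed.

Lemma finite_pinj_inj (T U : Type) (f : T -> option U) (x x' : T) (y : U) :
  finite_pinj f -> f x = Some y -> f x' = Some y -> x = x'.
Proof.
by move=> [_ fI] fx fx'; apply: fI; rewrite ?fx ?fx' //; apply: mem_set; rewrite /pdom /= ?fx ?fx'.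
Qed.

Lemma finite_pinj_ran (T U : Type) (f : T -> option U) :
  finite_pinj f -> finite_set [set y | exists x, f x = Some y].
Proof.
move=> [ffin _]; have := finite_image f ffin.
move=> /(finite_preimage (f := Some)) fin.
apply: sub_finite_set (fin _) => [y [x fx]|? ? _ _ [] //].
by exists x; rewrite // /pdom /= fx.
Qed.

Lemma demand_eq (A : Type) (F : set (set A)) (d d' : demand F) :
  dpt d = dpt d' -> dset d = dset d' -> d = d'.
Proof.
case: d d' => [h f a b c e] [h' f' a' b' c' e'] /= hh ff.
by subst; congr Demand; apply: Prop_irrelevance.
Qed.

Section HausdorffDemand.
Variable A : choiceType.
Local Notation demandA := (demand [set: set A]).
Local Notation demandH := (demand [set: set (hausdorff A)]).
Local Notation hpt := (@inl A (seq A * seq (seq bool))).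

Lemma hpt_inj : injective hpt. Proof. by move=> x y []. Qed.
Local Hint Resolve hpt_inj hset_inj : core.

Definition hdem (d : demandA) : demandH.
Proof.
exists (push_pfun hpt (dpt d)) (push_pfun (@hset A) (dset d)).
- exact/finite_pinj_push/dpt_finj.
- exact/finite_pinj_push/dset_finj.
- by [].
- move=> u v Z W /(push_pfunP _ hpt_inj) [x [y [dx -> ->]]].
  move=> /(push_pfunP _ (@hset_inj A)) [X [Y [dX -> ->]]].
  exact: (demand_compat dx dX).
Defined.

Lemma hdem_inj : injective hdem.
Proof.
move=> d d' dd; apply: demand_eq.
  exact: (push_pfun_inj hpt_inj (congr1 (@dpt _ _) dd)).
exact: (push_pfun_inj (@hset_inj A) (congr1 (@dset _ _) dd)).
Qed.

(** This allows values of [phi] chosen earlier to be carried to the next stage. *)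
Lemma satisfies_hsym (g : sym A) (d : demandA) : satisfies g d -> satisfies (hsym g) (hdem d).
Proof.
move=> [gd gD]; split=> [u v /(push_pfunP _ hpt_inj) [x [y [dx -> ->]]]|].
  by rewrite /= (gd _ _ dx).
move=> Z W /(push_pfunP _ (@hset_inj A)) [X [Y [dX -> ->]]].
by rewrite -hset_act (gD _ _ dX).
Qed.

(** Label a point by the enlarged sets of the domain containing it ([p]), and by those whose images
    contain it ([q]). A permutation extending the point map and carrying [p] to [q] satisfies the
    demand; it exists by [extend_fibrewise], since every atom minus a finite set has the size of
    [A]. *)
Lemma hdem_satisfiable (d : demandA) : infinite_set [set: A] ->
  exists g, satisfies g (hdem d).
Proof.
move=> Ainf.
pose D := pdom (dset d).
have DE X : D X -> exists Y, dset d X = Some Y.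
  by rewrite /D /pdom /=; case: (dset d X) => // Y _; exists Y.
pose im X := odflt X (dset d X).
have imI X X' : D X -> D X' -> im X = im X' -> X = X'.
  rewrite /im => /DE[Y dX] /DE[Y' dX']; rewrite dX dX' /= => YY.
  by apply: (finite_pinj_inj (dset_finj d) dX); rewrite YY.
pose p b := D `&` [set X | hset X b].
pose q b := D `&` [set X | hset (im X) b].
have Dfin : finite_set D by have [] := dset_finj d.
have := finite_pinj_push hpt_inj (dpt_finj d).
set h := push_pfun _ _ => hfin.
have atom c (R : set (hausdorff A)) (t : set (set A)) (W : set (hausdorff A)) :
    finite_set R -> (forall X X', D X -> D X' -> c X = c X' -> X = X') ->
    (forall b, W b <-> ~ R b /\ D `&` [set X | hset (c X) b] = t) ->
    t `<=` D -> W #= [set: A].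
  move=> Rfin cI WE tD; apply/card_eqPle; split.
    exact: card_le_trans (card_leT _) (card_hausdorff Ainf).
  apply: card_le_trans (card_atom t Ainf Dfin Rfin cI) _.
  apply: subset_card_le => b /= [Rb tb]; apply/WE; split=> //.
  apply/seteqP; split=> X => [[DX]|tX]; first by move/(tb _ DX).
  by split; [exact: tD|apply/(tb _ (tD _ tX))].
have [||t|g [gh gq]] := @extend_fibrewise _ _ p q h.
(* The point map respects the labels precisely because of the compatibility condition on demands. *)
- move=> u v /(push_pfunP _ hpt_inj) [x [y [dx -> ->]]].
  apply/seteqP; split=> X [DX]; rewrite /= => Xx; split=> //=; have [Y dX] := DE _ DX.
    by move: Xx; rewrite /im dX /= => Yy; apply/(demand_compat dx dX).
  by rewrite /im dX /=; apply/(demand_compat dx dX).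
- by move=> u u' v; apply: finite_pinj_inj.
(* A label not contained in [D] is never attained, so both fibres are empty. *)
- have [tD|tD] := pselect (t `<=` D); last first.
    set U := [set _ | _]; set V := [set _ | _].
    have -> : U = set0.
      by apply/seteqP; split=> // b [_ pt]; apply: tD; rewrite -pt; apply: subIsetl.
    have -> // : V = set0.
    by apply/seteqP; split=> // b [_ pt]; apply: tD; rewrite -pt; apply: subIsetl.
  apply: (@card_eq_trans _ _ _ _ [set: A]); last rewrite card_eq_sym.
    apply: (atom id (pdom h) t) => // [|b]; first by case: hfin.
    by rewrite /pdom /=; case: (h b) => [?|]; split=> -[] // _ ?; split.
  apply: (atom im [set y | exists x, h x = Some y] t) => // [|b].
    exact: finite_pinj_ran.
  by split=> -[/= hb qb]; split=> //; [case=> x /hb|move=> x hx; apply: hb; exists x].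
exists g; split=> // Z W /(push_pfunP _ (@hset_inj A)) [X [Y [dX -> ->]]].
have DX : D X by rewrite /D /pdom /= dX.
have gX b : hset Y (g b) <-> hset X b.
  have := gq b => /seteqP[qp pq]; split=> Hb.
    by have [] : p b X by apply: qp; split=> //; rewrite /= /im dX.
  by have [_] : q (g b) X by [apply: pq]; rewrite /= /im dX.
have [g' _ gK] := sym_bij g.
apply/seteqP; split=> [_ [b Xb <-]|b]; first exact/gX.
by rewrite -{1}(gK b) => /gX Xb; exists (g' b).
Qed.

End HausdorffDemand.

(** The data of a structure with all subsets and all permutations: [phi] is recorded by its values
    on generators. Infinity is kept as an invariant, since each step relies on it. *)
Record stage_data := StageData {
  sd_type : choiceType;
  sd_inf : infinite_set [set: sd_type];
  sd_dom : set (demand [set: set sd_type]);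
  sd_psi : demand [set: set sd_type] -> sym sd_type;
  sd_sat : forall d, sd_dom d -> satisfies (sd_psi d) d
}.

(** * Multi-embeddings and sequential systems *)

Lemma subgroup_setT (G : groupType) : subgroup [set: G].
Proof. by split=> [|u v _ _]; apply: mem_set. Qed.

Definition full_structure (s : stage_data) : structure.
Proof.
exists (sd_type s) [set: set (sd_type s)] [set: sym (sd_type s)] (@sd_dom s)
  (free_eval (@sd_psi s)) => //.
- exact: subgroup_setT.
- by move=> u v _ _; apply: free_evalM.
- by move=> d /sd_sat; rewrite free_eval_gen.
Defined.

Definition id_embedding (T : structure) : multi_embedding T T.
Proof. by exists id id id id => // d; rewrite image_id. Defined.

Definition comp_embedding (T0 T1 T2 : structure) (Psi : multi_embedding T1 T2)
  (Phi : multi_embedding T0 T1) : multi_embedding T0 T2.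
Proof.
exists (Psi \o Phi) (emb_set Psi \o emb_set Phi) (emb_dem Psi \o emb_dem Phi)
  (emb_sym Psi \o emb_sym Phi).
- exact: inj_comp (@emb_pt_inj _ _ Psi) (@emb_pt_inj _ _ Phi).
- by move=> X /(@emb_set_fun _ _ Phi)/(@emb_set_fun _ _ Psi).
- move=> X Y /[dup] /set_mem/(@emb_set_fun _ _ Phi) FX XF.
  move=> /[dup] /set_mem/(@emb_set_fun _ _ Phi) FY YF.
  by move=> /(@emb_set_inj _ _ Psi _ _ (mem_set FX) (mem_set FY))/(@emb_set_inj _ _ Phi); apply.
- exact: inj_comp (@emb_dem_inj _ _ Psi) (@emb_dem_inj _ _ Phi).
- by move=> g /(@emb_sym_fun _ _ Phi)/(@emb_sym_fun _ _ Psi).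
- move=> X Y /[dup] /set_mem/(@emb_sym_fun _ _ Phi) FX XF.
  move=> /[dup] /set_mem/(@emb_sym_fun _ _ Phi) FY YF.
  by move=> /(@emb_sym_inj _ _ Psi _ _ (mem_set FX) (mem_set FY))/(@emb_sym_inj _ _ Phi); apply.
- move=> g g' Gg Gg'; rewrite /= (emb_sym_morph Phi)// (emb_sym_morph Psi)//; exact: emb_sym_fun.
- move=> x X FX; apply: iff_trans (emb_mem Phi x FX) _.
  exact/emb_mem/emb_set_fun.
- by move=> d; rewrite -image_comp !emb_dpt_dom.
- by move=> d; rewrite -image_comp !emb_dset_dom.
- by move=> d x y /(emb_dpt Phi)/(emb_dpt Psi).
- by move=> d x y /(emb_dset Phi)/(emb_dset Psi).
- by move=> g x Gg; rewrite /= (emb_act_pt Phi)// (emb_act_pt Psi)//; exact: emb_sym_fun.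
- move=> g X Gg FX; rewrite /= (emb_act_set Phi)// (emb_act_set Psi)//; first exact: emb_sym_fun.
  exact: emb_set_fun.
- by move=> d /(emb_dom_phi Phi)/(emb_dom_phi Psi).
- by move=> d dd; rewrite /= (emb_phi Phi)// (emb_phi Psi)//; exact: emb_dom_phi.
Defined.

(** By proof irrelevance the category laws become equalities, so the laws of a direct system follow
    by rewriting. *)
Lemma embedding_eq (T0 T1 : structure) (Phi Psi : multi_embedding T0 T1) :
  emb_pt Phi = emb_pt Psi -> emb_set Phi = emb_set Psi ->
  emb_dem Phi = emb_dem Psi -> emb_sym Phi = emb_sym Psi -> Phi = Psi.
Proof.
case: Phi Psi => [a b c d ? ? ? ? ? ? ? ? ? ? ? ? ? ? ? ?]
  [a' b' c' d' ? ? ? ? ? ? ? ? ? ? ? ? ? ? ? ?] /=.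
by move=> ? ? ? ?; subst; congr MultiEmbedding; apply: Prop_irrelevance.
Qed.

Lemma comp_embeddingA (T0 T1 T2 T3 : structure) (Chi : multi_embedding T2 T3)
    (Psi : multi_embedding T1 T2) (Phi : multi_embedding T0 T1) :
  comp_embedding Chi (comp_embedding Psi Phi) = comp_embedding (comp_embedding Chi Psi) Phi.
Proof. exact: embedding_eq. Qed.

Lemma comp_id_embedding (T0 T1 : structure) (Phi : multi_embedding T0 T1) :
  comp_embedding (id_embedding T1) Phi = Phi.
Proof. exact: embedding_eq. Qed.

Lemma comp_embedding_id (T0 T1 : structure) (Phi : multi_embedding T0 T1) :
  comp_embedding Phi (id_embedding T0) = Phi.
Proof. exact: embedding_eq. Qed.

Section SequentialSystem.
Variables (T : nat -> structure) (step : forall n, multi_embedding (T n) (T n.+1)).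

(** The target index is [k + m], not [m + k], so that the successor case typechecks by
    computation. *)
Fixpoint climb (m k : nat) : multi_embedding (T m) (T (k + m)) :=
  match k with
  | 0 => id_embedding (T m)
  | k.+1 => comp_embedding (step (k + m)) (climb m k)
  end.

Definition climb_to (m n k : nat) (e : k + m = n) : multi_embedding (T m) (T n) :=
  match e in _ = n return multi_embedding (T m) (T n) with erefl => climb m k end.

Lemma climb_to0 (n : nat) (e : 0 + n = n) : climb_to e = id_embedding (T n).
Proof. by rewrite (eq_irrelevance e erefl). Qed.

Lemma climb_toS (m n k : nat) (e : k + m = n) (e' : k.+1 + m = n.+1) :
  climb_to e' = comp_embedding (step n) (climb_to e).
Proof. by case: n / e e' => e'; rewrite (eq_irrelevance e' erefl). Qed.

Lemma climb_toD (i j k a b : nat) (ij : a + i = j) (jk : b + j = k) (ik : (b + a) + i = k) :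
  comp_embedding (climb_to jk) (climb_to ij) = climb_to ik.
Proof.
elim: b k jk ik => [|b IH] k jk ik.
  by case: k / jk ik => ik; rewrite climb_to0 comp_id_embedding (eq_irrelevance ij ik).
case: k jk ik => [|k] jk ik; first by [].
have jk' : b + j = k by case: jk.
have ik' : b + a + i = k by case: ik.
by rewrite (climb_toS jk') (climb_toS ik') -comp_embeddingA (IH _ _ ik').
Qed.

Definition climb_bond (m n : nat) (mn : m <= n) : multi_embedding (T m) (T n) :=
  climb_to (subnK mn).

(** A bond may be computed from any decomposition of [n], as equality proofs on [nat] are unique. *)
Lemma climb_bondE (m n k : nat) (mn : m <= n) (e : k + m = n) : climb_bond mn = climb_to e.
Proof.
have kE : n - m = k by rewrite -e addnK.
rewrite /climb_bond; move: (subnK mn); rewrite kE => e'.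
by rewrite (eq_irrelevance e' e).
Qed.

Lemma climb_bond_id (n : nat) : climb_bond (leqnn n) = id_embedding (T n).
Proof. by rewrite (climb_bondE _ (erefl : 0 + n = n)). Qed.

Lemma climb_bondS (n : nat) : climb_bond (leqnSn n) = step n.
Proof.
by rewrite (climb_bondE _ (erefl : 1 + n = n.+1)) /= comp_embedding_id.
Qed.

Lemma climb_bond_comp (i j k : nat) (ij : i <= j) (jk : j <= k) :
  comp_embedding (climb_bond jk) (climb_bond ij) = climb_bond (leq_trans ij jk).
Proof.
have e : (k - j) + (j - i) + i = k by rewrite -addnA !subnK.
by rewrite (climb_bondE _ e); apply: climb_toD.
Qed.

Definition sequential_system : direct_system.
Proof.
exists T climb_bond => [n|i j k ij jk] /=.
  by rewrite climb_bond_id.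
by rewrite -climb_bond_comp.
Defined.

End SequentialSystem.

(** * The successor stage *)

Section NextStage.
Variable s : stage_data.
Local Notation A := (sd_type s).

(** Old demands must receive the transported old permutation, by condition (d); the other
    transported ones receive any satisfying permutation. Injectivity of [hdem] makes the cases
    unambiguous. *)
Lemma next_psi_ex : exists psi : demand [set: set (hausdorff A)] -> sym (hausdorff A),
  forall d, satisfies (psi (hdem d)) (hdem d) /\
    (sd_dom d -> psi (hdem d) = hsym (sd_psi d)).
Proof.
have psi_ex : forall d' : demand [set: set (hausdorff A)], exists g : sym (hausdorff A),
    forall d, d' = hdem d -> satisfies g d' /\ (sd_dom d -> g = hsym (sd_psi d)).
  move=> d'; have [[d ->]|nd] := pselect (exists d, d' = hdem d); last first.
    (* Demands that are not transported get the identity as a default. *)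
    by exists 1 => d dd; case: nd; exists d.
  have [dom|ndom] := pselect (sd_dom d).
    exists (hsym (sd_psi d)) => d1 /(@hdem_inj A) <-; split=> //.
    exact/satisfies_hsym/sd_sat.
  have [g gd] := hdem_satisfiable d (@sd_inf s).
  by exists g => d1 /(@hdem_inj A) <-.
have [psi psiP] := @choice _ _ _ psi_ex.
by exists psi => d; apply: psiP.
Qed.

Definition next_psi := projT1 (cid next_psi_ex).

Lemma next_psiP d : satisfies (next_psi (hdem d)) (hdem d) /\
    (sd_dom d -> next_psi (hdem d) = hsym (sd_psi d)).
Proof. exact: (projT2 (cid next_psi_ex)). Qed.

Lemma hausdorff_infinite : infinite_set [set: hausdorff A].
Proof.
apply/infiniteP; apply: card_le_trans ((infiniteP _).1 (@sd_inf s)) _.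
exact: inj_le_card (@hpt_inj A).
Qed.

(** The domain is the whole range of [hdem], which makes the next embedding successful. *)
Definition next_stage : stage_data.
Proof.
exists (hausdorff A) (range (@hdem A)) next_psi; first exact: hausdorff_infinite.
by move=> _ [d _ <-]; case: (next_psiP d).
Defined.

Definition next_embedding : multi_embedding (full_structure s) (full_structure next_stage).
Proof.
exists inl (@hset A) (@hdem A) (@hsym A) => //=.
- exact: hpt_inj.
- by move=> X Y _ _; apply: hset_inj.
- exact: hdem_inj.
- by move=> g g' _ _; apply: hsym_inj.
- by move=> g g' _ _; apply: hsymM.
- by move=> d; apply: pdom_push; apply: hpt_inj.
- by move=> d; apply: pdom_push; apply: hset_inj.
- by move=> d x y dx; rewrite push_pfunE ?dx //; apply: hpt_inj.
- by move=> d X Y dX; rewrite push_pfunE ?dX //; apply: hset_inj.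
- by move=> g X _ _; apply: hset_act.
- by move=> d _; exists d.
- by move=> d dd; rewrite !free_eval_gen (next_psiP d).2.
Defined.

End NextStage.

(* [iter] is stuck at a universe too small for [stage_data]. *)
Fixpoint nth_stage (s : stage_data) (n : nat) : stage_data :=
  if n is n'.+1 then next_stage (nth_stage s n') else s.

Theorem theorem3p7 (A0 : Type) (A0_infinite : infinite_set [set: A0]) :
  exists S : direct_system,
    [/\ successful_system S,
        carrier (S 0) = A0
      & forall n : nat,
          [/\ [set: S n] #= [set: A0],
              setfam (S n) = [set: set (S n)]
            & symgrp (S n) = [set: sym (S n)]]].
Proof.
(* [classic] puts a choice structure on [A0] itself, so the first carrier is [A0] by conversion. *)
pose s0 : stage_data := @StageData {classic A0} A0_infinite set0
  (fun=> 1) (fun d (f : set0 d) => False_ind _ f).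
pose s := nth_stage s0.
exists (sequential_system (fun n => next_embedding (s n))); split=> //.
- move=> i; exists i.+1, (leqnSn i); rewrite /= climb_bondS => d.
  by exists d.
- move=> n; split=> //; elim: n => [|n IH]; first exact: card_eqxx.
  apply: card_eq_trans IH; apply/card_eqPle; split.
    exact: card_hausdorff (@sd_inf (s n)).
  exact: inj_le_card (@hpt_inj (sd_type (s n))).
Qed.
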